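(* Let an arbitrary collection of numbers $\{\lambda_k,\beta_k\ (k=1,\dots,N)\}$ be given. In order for this collection to be the spectral data for some $N\times N$ real Jacobi matrix $J$ (entries $a_n,b_n\in\mathbb{R}$, $a_n\ne0$), it is necessary and sufficient that the following two conditions be satisfied: (i) the numbers $\lambda_1,\dots,\lambda_N$ are real and distinct; (ii) the numbers $\beta_1,\dots,\beta_N$ are positive and such that $\sum_{k=1}^{N}\beta_k=1$.
   Context: $N$ is a positive integer. A real Jacobi matrix $J$ here is an $N\times N$ symmetric tridiagonal matrix (rows and columns indexed $0,\dots,N-1$) with diagonal entries $b_0,\dots,b_{N-1}\in\mathbb{R}$, with nonzero entries $a_n\in\mathbb{R}$ in positions $(n,n+1)$ and $(n+1,n)$ for $0\le n\le N-2$, and zeros elsewhere. Such a matrix has precisely $N$ real and distinct eigenvalues. Put $a_{N-1}=1$. The polynomials $P_0(\lambda),\dots,P_N(\lambda)$ associated with $J$ are defined by $P_0(\lambda)=1$, $b_0P_0(\lambda)+a_0P_1(\lambda)=\lambda P_0(\lambda)$, $a_{n-1}P_{n-1}(\lambda)+b_nP_n(\lambda)+a_nP_{n+1}(\lambda)=\lambda P_n(\lambda)$ for $n\in\{1,\dots,N-1\}$. $\mathbb{C}_m[\lambda]$ is the space of polynomials of degree $\le m$ with complex coefficients. The generalized spectral function of $J$ is the unique linear functional $\Omega:\mathbb{C}_{2N}[\lambda]\to\mathbb{C}$ such that $\langle\Omega,P_mP_n\rangle=\delta_{mn}$ for $m,n\in\{0,\dots,N-1\}$ and $\langle\Omega,P_mP_N\rangle=0$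 for $m\in\{0,\dots,N\}$. The spectral data of a real Jacobi matrix $J$ is the collection $\{\lambda_k,\beta_k\ (k=1,\dots,N)\}$, where $\lambda_1,\dots,\lambda_N$ are the eigenvalues of $J$ and $\beta_1,\dots,\beta_N$ (the normalizing numbers) are the uniquely determined numbers with $\langle\Omega,G\rangle=\sum_{k=1}^N\beta_kG(\lambda_k)$ for all $G\in\mathbb{C}_{2N}[\lambda]$; equivalently, $\beta_k=\big\{\sum_{n=0}^{N-1}P_n^2(\lambda_k)\big\}^{-1}$. *)

(* Defs.v *)
From HB Require Import structures.
From mathcomp Require Import all_boot all_order all_algebra.
From mathcomp Require Import reals.
From mathcomp Require Import complex.

Set Implicit Arguments.
Unset Strict Implicit.
Unset Printing Implicit Defensive.

Import Order.TTheory GRing.Theory Num.Theory.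
Local Open Scope ring_scope.

Section JacobiPolynomials.
Variables (F : fieldType) (N : nat).
Implicit Type J : 'M[F]_N.

Definition jacobi_matrix J : Prop :=
  [/\ J^T = J,
      forall i j : 'I_N, (i.+1 < j)%N -> J i j = 0
    & forall i j : 'I_N, j = i.+1 :> nat -> J i j != 0].

(* b_n for n < N; the value 0 for n >= N is junk. *)
Definition diag_entry J (n : nat) : F :=
  if insub n is Some i then J i i else 0.

(* a_n for n.+1 < N; the default value 1 implements the convention
   a_(N-1) = 1. *)
Definition offdiag_entry J (n : nat) : F :=
  match insub n, insub n.+1 with
  | Some i, Some j => J i j
  | _, _ => 1
  end.

(* P_n, by solving the three-term recurrence for its last term; only the
   values at n <= N are meaningful (see jacobi_poly_rec0, jacobi_poly_rec). *)
Fixpoint jacobi_poly J (n : nat) : {poly F} :=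
  match n with
  | 0 => 1
  | m.+1 =>
    (offdiag_entry J m)^-1 *:
      (('X - (diag_entry J m)%:P) * jacobi_poly J m
       - (if m is l.+1 then offdiag_entry J l *: jacobi_poly J l else 0))
  end.

Lemma offdiag_entry_neq0 J n : jacobi_matrix J -> offdiag_entry J n != 0.
Proof.
move=> [_ _ J_neq0]; rewrite /offdiag_entry.
case: insubP => [i _ i_n|_]; last exact: oner_neq0.
case: insubP => [j _ j_n|_]; last exact: oner_neq0.
by apply: J_neq0; rewrite j_n i_n.
Qed.

Lemma jacobi_poly_rec0 J : jacobi_matrix J ->
  diag_entry J 0 *: jacobi_poly J 0 + offdiag_entry J 0 *: jacobi_poly J 1
    = 'X * jacobi_poly J 0.
Proof.
move=> /offdiag_entry_neq0 a_neq0 /=.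
by rewrite scalerA mulfV // scale1r subr0 -mul_polyC !mulr1 addrC subrK.
Qed.

Lemma jacobi_poly_rec J n : jacobi_matrix J ->
  offdiag_entry J n *: jacobi_poly J n
  + diag_entry J n.+1 *: jacobi_poly J n.+1
  + offdiag_entry J n.+1 *: jacobi_poly J n.+2 = 'X * jacobi_poly J n.+1.
Proof.
move=> /offdiag_entry_neq0 a_neq0.
have -> : jacobi_poly J n.+2 = (offdiag_entry J n.+1)^-1 *:
    (('X - (diag_entry J n.+1)%:P) * jacobi_poly J n.+1
     - offdiag_entry J n *: jacobi_poly J n) by [].
move: (jacobi_poly J n) (jacobi_poly J n.+1) => p q.
by rewrite scalerA mulfV // scale1r mulrBl mul_polyC addrC addrA !subrK.
Qed.

Lemma size_jacobi_poly J n : jacobi_matrix J -> size (jacobi_poly J n) = n.+1.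
Proof.
move=> Jjac; have a_neq0 := offdiag_entry_neq0 _ Jjac.
elim/ltn_ind: n => -[_|n IH]; first by rewrite size_poly1.
rewrite [jacobi_poly _ _]/= size_scale ?invr_eq0 //.
have szn := IH n (ltnSn n).
have szXn : size (('X - (diag_entry J n)%:P) * jacobi_poly J n) = n.+2.
  by rewrite size_monicM ?monicXsubC ?size_XsubC -?size_poly_eq0 ?szn.
rewrite size_polyDl szXn // size_polyN.
case: n => [|n] in IH {szn szXn} *; first by rewrite size_poly0.
by rewrite size_scale // IH.
Qed.

End JacobiPolynomials.

Section SpectralData.
Variables (R : realType) (N : nat).
Implicit Type J : 'M[R]_N.
Local Notation C := R[i].

Definition complexify J : 'M[C]_N := map_mx (real_complex R) J.

(* {poly_(2 * N).+1 C} is the space of polynomials of degree at most 2N;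
   npolyp casts a polynomial of degree at most 2N into it. *)
Definition generalized_spectral_function J
    (Omega : {scalar {poly_(2 * N).+1 C}}) : Prop :=
  let P := jacobi_poly (complexify J) in
  (forall m n : nat, (m < N)%N -> (n < N)%N ->
     Omega (npolyp (2 * N).+1 (P m * P n)) = (m == n)%:R) /\
  (forall m : nat, (m <= N)%N ->
     Omega (npolyp (2 * N).+1 (P m * P N)) = 0).

(* Neither reality nor injectivity of lambda is assumed; [eigenvalue] uses
   row eigenvectors, which is harmless since J is symmetric. Omega is unique
   when J is a Jacobi matrix: generalized_spectral_function_unique. *)
Definition spectral_data J (lambda beta : 'I_N -> C) : Prop :=
  (forall x : C, eigenvalue (complexify J) x <-> exists k, x = lambda k) /\
  exists2 Omega : {scalar {poly_(2 * N).+1 C}},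
    generalized_spectral_function J Omega &
    forall G : {poly_(2 * N).+1 C}, Omega G = \sum_k beta k * G.[lambda k].

Lemma jacobi_complexify J : jacobi_matrix J -> jacobi_matrix (complexify J).
Proof.
move=> [Jsym Jtri J_neq0]; split=> [|i j ij|i j ij].
- by apply/matrixP => i j; rewrite !mxE -[in RHS]Jsym mxE.
- by rewrite mxE Jtri.
- by rewrite mxE fmorph_eq0 J_neq0.
Qed.

Lemma generalized_spectral_function_unique J
    (Omega Omega' : {scalar {poly_(2 * N).+1 C}}) : jacobi_matrix J ->
  generalized_spectral_function J Omega ->
  generalized_spectral_function J Omega' -> Omega =1 Omega'.
Proof.
move=> /jacobi_complexify Jjac [O1 O2] [O1' O2'].
pose P := jacobi_poly (complexify J).
pose np := npolyp (R := C) (2 * N).+1.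
have agree m n : (m <= N)%N -> (n <= N)%N ->
    Omega (np (P m * P n)) = Omega' (np (P m * P n)).
  rewrite (leq_eqVlt m) (leq_eqVlt n).
  case/predU1P=> [->|mN]; case/predU1P=> [->|nN].
  - by rewrite O2 // O2'.
  - by rewrite mulrC O2 ?O2' // ltnW.
  - by rewrite O2 ?O2' // ltnW.
  - by rewrite O1 // O1'.
suff H d (G : {poly_(2 * N).+1 C}) : (size G <= d)%N -> Omega G = Omega' G.
  by move=> G; apply: (H (size G)).
elim: d G => [|d IH] G szG.
  have -> : G = 0 by apply/val_inj/eqP; rewrite -size_poly_leq0.
  by rewrite !linear0.
have [dN|] := leqP d (2 * N); last first.
  by move=> dN; apply: IH; apply: leq_trans dN; apply: size_npoly.
have [m [n [mN nN mn]]] : exists m n, [/\ m <= N, n <= N & m + n = d]%N.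
  exists (minn d N), (d - N)%N; split; first exact: geq_minr.
    by rewrite leq_subLR addnn -mul2n.
  by rewrite minnE subnK // leq_subr.
pose Q := P m * P n.
have szQ : size Q = d.+1.
  have [szm szn] := (size_jacobi_poly m Jjac, size_jacobi_poly n Jjac).
  by rewrite size_mul -?size_poly_eq0 ?szm ?szn // addSn addnS mn.
have npQ : np Q = Q :> {poly C} by rewrite npolypK // szQ ltnS.
have lcQ : Q`_d != 0.
  by rewrite -[d]/(d.+1.-1) -szQ -lead_coefE lead_coef_eq0 -size_poly_eq0 szQ.
pose c := G`_d / Q`_d.
suff : Omega (G - c *: np Q) = Omega' (G - c *: np Q).
  by rewrite !linearB !linearZ /= agree // => /addIr.
apply: IH.
apply/leq_sizeP => j; rewrite leq_eqVlt => /predU1P[<-|dj] /=;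
  rewrite coefB coefZ npQ.
  by rewrite /c divfK // subrr.
rewrite (nth_default _ (leq_trans szG dj)) nth_default ?szQ //.
by rewrite mulr0 subrr.
Qed.

End SpectralData.

(* Main.v *)
Require Import Defs.
From HB Require Import structures.
From mathcomp Require Import all_boot all_order all_algebra.
From mathcomp Require Import reals.
From mathcomp Require Import complex.

Set Implicit Arguments.
Unset Strict Implicit.
Unset Printing Implicit Defensive.

Import Order.TTheory GRing.Theory Num.Theory.
Local Open Scope ring_scope.

(* Write A for the N x N matrix of values P_m(lambda_k).  Orthonormality of
   P_0, ..., P_(N-1) for the discrete functional G |-> sum_k beta_k G(lambda_k)
   says A diag(beta) A^T = 1, equivalently A^T A diag(beta) = 1.
   Necessity: the latter identity forces the lambda_k to be distinct and
   beta_k sum_m P_m(lambda_k)^2 = 1, while the lambda_k are real because J is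
   symmetric.
   Sufficiency: Gram-Schmidt on 1, X, X^2, ... gives orthonormal p_0, ...,
   p_(N-1) with p_0 = 1 and deg p_n = n.  The matrix J of multiplication by X,
   J_mn = <X p_m, p_n>, is a Jacobi matrix with J A = A diag(lambda); hence the
   lambda_k are its eigenvalues and P_n(lambda_k) = p_n(lambda_k), where
   P_N(lambda_k) = 0. *)

(** * Eigenvalues of Hermitian and of diagonalized matrices *)

(** Multiplying [x] by the positive squared norm [s] of an eigenvector [v] gives the Hermitian form
    of [A] at [v], which equals its own conjugate. *)
Lemma eigenvalue_hermitian_real (C : numClosedFieldType) (n : nat)
    (A : 'M[C]_n) (x : C) :
  (forall i j, (A i j)^* = A j i) -> eigenvalue A x -> x \is Num.real.
Proof.
move=> Aherm /eigenvalueP[v vA v_neq0].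
pose s := \sum_j v 0 j * (v 0 j)^*.
have s_gt0 : 0 < s.
  have /rV0Pn[i vi_neq0] := v_neq0.
  rewrite /s (bigD1 i) //= ltr_wpDr ?mul_conjC_gt0 //.
  by apply: sumr_ge0 => j _; apply: mul_conjC_ge0.
have xs : x * s = \sum_j \sum_i v 0 i * A i j * (v 0 j)^*.
  rewrite mulr_sumr; apply: eq_bigr => j _.
  by rewrite -mulr_suml mulrA; move/rowP/(_ j): vA; rewrite !mxE => ->.
have s_real : s \is Num.real by apply: gtr0_real.
suff xs_real : x * s \is Num.real.
  by rewrite -[x](mulfK (lt0r_neq0 s_gt0)) realM ?realV.
apply/CrealP; rewrite xs rmorph_sum exchange_big /=; apply: eq_bigr => i _.
rewrite rmorph_sum; apply: eq_bigr => j _.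
by rewrite !rmorphM /= conjCK Aherm mulrC [_^* * _]mulrC mulrA.
Qed.

(** If [v] is a row eigenvector of [J], then [v *m A] is one of the diagonal matrix, and any nonzero
    coordinate of it identifies [x]. Conversely, the rows of [invmx A] are eigenvectors of [J]. *)
Lemma eigenvalue_similar_diag (F : fieldType) (n : nat) (J A : 'M[F]_n)
    (d : 'rV[F]_n) (x : F) :
  A \in unitmx -> J *m A = A *m diag_mx d ->
  eigenvalue J x <-> exists k, x = d 0 k.
Proof.
move=> Aunit JA; split=> [/eigenvalueP[v vJ v_neq0]|[k ->]].
  have wD : (v *m A) *m diag_mx d = x *: (v *m A).
    by rewrite -mulmxA -JA mulmxA vJ -scalemxAl.
  have /rV0Pn[k wk_neq0] : v *m A != 0.
    by apply: contra_neq v_neq0 => vA0; rewrite -[v](mulmxK Aunit) vA0 mul0mx.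
  exists k; apply: (mulfI wk_neq0); move: (v *m A) wD => w /rowP/(_ k).
  by rewrite mul_mx_diag !mxE [x * _]mulrC.
apply/eigenvalueP; exists (delta_mx 0 k *m invmx A).
  rewrite -[J](mulmxK Aunit) JA -!mulmxA mulKmx // mulmxA scalemxAl.
  congr (_ *m _); apply/rowP => j; rewrite mul_mx_diag !mxE eqxx /=.
  by case: eqP => [->|_]; rewrite ?mulr1 ?mul1r ?mulr0 ?mul0r.
apply/negP => /eqP /(congr1 (mulmx^~ A)); rewrite mulmxKV // mul0mx.
by move=> /rowP/(_ k); rewrite !mxE !eqxx => /eqP; rewrite oner_eq0.
Qed.

(** * Jacobi matrices and the three-term recurrence *)

Lemma sum_ord_if_eq (V : nmodType) (n : nat) (f : nat -> V) (m : nat) :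
  \sum_(j < n) (if j == m :> nat then f j else 0)
    = if (m < n)%N then f m else 0.
Proof.
rewrite -big_mkcond; case: ltnP => [mn|nm].
  by rewrite (big_pred1 (Ordinal mn)).
by rewrite big1 // => j /eqP jm; move: (ltn_ord j); rewrite jm ltnNge nm.
Qed.

Lemma jacobi_polyS (F : fieldType) (N : nat) (J : 'M[F]_N) (n : nat) :
  jacobi_poly J n.+1 = (offdiag_entry J n)^-1 *:
    (('X - (diag_entry J n)%:P) * jacobi_poly J n
     - (if n is l.+1 then offdiag_entry J l *: jacobi_poly J l else 0)).
Proof. by []. Qed.

Section JacobiRecurrence.
Variables (F : fieldType) (N : nat) (J : 'M[F]_N).
Hypothesis Jjac : jacobi_matrix J.

(* The last summand is junk for i = N - 1, so u N = 0 makes it vanish. *)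
Lemma jacobi_row_sum (u : nat -> F) (i : 'I_N) : u N = 0 ->
  \sum_j J i j * u j =
    (if i : nat is l.+1 then offdiag_entry J l * u l else 0)
    + diag_entry J i * u i + offdiag_entry J i * u i.+1.
Proof.
move=> uN; have [Jsym Jtri _] := Jjac.
have JC j k : J j k = J k j by rewrite -[in LHS]Jsym mxE.
have diagE (j : 'I_N) : diag_entry J j = J j j by rewrite /diag_entry valK.
have offE (j k : 'I_N) : k = j.+1 :> nat -> offdiag_entry J j = J j k.
  by move=> kj; rewrite /offdiag_entry -kj !valK.
pose lower j := offdiag_entry J j * u j.
pose mid j := diag_entry J j * u j.
pose upper j := offdiag_entry J i * u j.
(* The three conditions on [j] exclude each other, and each selects at most one index, so the three
   resulting sums collapse. *)
have entryE (j : 'I_N) : J i j * u j =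
    (if j.+1 == i then lower j else 0) + (if j == i :> nat then mid j else 0)
    + (if j == i.+1 :> nat then upper j else 0).
  rewrite /lower /mid /upper.
  case: (ltngtP i j) => [ij|ji|/ord_inj ij].
  - rewrite [j.+1 == i]gtn_eqF ?ltnS 1?ltnW // !add0r.
    case: eqP => [/offE ->//|/eqP ij'].
    by rewrite Jtri ?mul0r // ltn_neqAle eq_sym ij'.
  - rewrite (ltn_eqF (ltnW ji : (j < i.+1)%N)) !addr0.
    case: eqP => [/esym/offE ->|/eqP ij']; first by rewrite JC.
    by rewrite JC Jtri ?mul0r // ltn_neqAle ij'.
  - by rewrite ij diagE (ltn_eqF (ltnSn j)) gtn_eqF // add0r addr0.
rewrite (eq_bigr _ (fun j _ => entryE j)) !big_split /=.
rewrite !sum_ord_if_eq ltn_ord /mid; congr (_ + _ + _).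
  case: i {entryE upper} => -[|l] iN /=; first by rewrite big1.
  rewrite (eq_bigr (fun j : 'I_N => if j == l :> nat then lower j else 0)) //.
  by rewrite sum_ord_if_eq ltnW.
rewrite /upper; case: ltnP => // Ni.
by rewrite (_ : i.+1 = N) ?uN ?mulr0 //; apply/eqP; rewrite eqn_leq ltn_ord.
Qed.

Lemma horner_jacobi_polyS (n : nat) (x : F) :
  (jacobi_poly J n.+1).[x] = (offdiag_entry J n)^-1 *
    ((x - diag_entry J n) * (jacobi_poly J n).[x]
     - (if n is l.+1 then offdiag_entry J l * (jacobi_poly J l).[x] else 0)).
Proof.
rewrite jacobi_polyS hornerZ hornerD hornerN hornerM !hornerE.
by case: n => [|n]; rewrite ?horner0 ?hornerZ.
Qed.

(** The recurrence at index N - 1 contains a term in P_N that the last row of [J] lacks; it vanishes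
    at a root of P_N. *)
Lemma jacobi_poly_eigen (x : F) (i : 'I_N) : (jacobi_poly J N).[x] = 0 ->
  \sum_j J i j * (jacobi_poly J j).[x] = x * (jacobi_poly J i).[x].
Proof.
move=> PN; rewrite (jacobi_row_sum (u := fun j => (jacobi_poly J j).[x])) //.
rewrite horner_jacobi_polyS mulVKf ?offdiag_entry_neq0 //.
by rewrite addrC mulrBl addrA !subrK.
Qed.

(** Every a_n is nonzero, so each row of the eigenvector equation determines the next value from the
    earlier ones. The last row then yields P_N(x) = 0. *)
Lemma jacobi_poly_unique (u : nat -> F) (x : F) : u 0%N = 1 -> u N = 0 ->
  (forall i : 'I_N, \sum_j J i j * u j = x * u i) ->
  forall n, (n <= N)%N -> (jacobi_poly J n).[x] = u n.
Proof.
move=> u0 uN uJ; elim/ltn_ind=> -[_ _|n IH nN]; first by rewrite u0 hornerE.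
rewrite horner_jacobi_polyS IH //; last exact: ltnW.
apply: (canLR (mulKf (offdiag_entry_neq0 n Jjac))).
have := uJ (Ordinal nN); rewrite jacobi_row_sum //= => uJn.
rewrite mulrBl -uJn; case: n IH nN uJn => [|n] IH nN _.
  by rewrite add0r subr0 addrC addKr.
rewrite (IH n (leqnSn _) (ltnW (ltnW nN))) -(addrA (_ * u n)) addrAC.
by rewrite [_ * u n + _]addrC addrK addrC addKr.
Qed.

End JacobiRecurrence.

Lemma map_jacobi_poly (F K : fieldType) (f : {rmorphism F -> K}) (N : nat)
    (J : 'M[F]_N) (n : nat) :
  jacobi_poly (map_mx f J) n = map_poly f (jacobi_poly J n).
Proof.
have diagE m : diag_entry (map_mx f J) m = f (diag_entry J m).
  by rewrite /diag_entry; case: insub => [i|]; rewrite ?mxE ?rmorph0.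
have offE m : offdiag_entry (map_mx f J) m = f (offdiag_entry J m).
  rewrite /offdiag_entry; case: insub => [i|]; last by rewrite rmorph1.
  by case: insub => [j|]; rewrite ?mxE ?rmorph1.
elim/ltn_ind: n => -[_|n IH]; first by rewrite /= rmorph1.
rewrite !jacobi_polyS map_polyZ fmorphV rmorphB rmorphM rmorphB /=.
rewrite map_polyX map_polyC /= offE diagE IH //.
case: n IH => [|n] IH; first by rewrite rmorph0.
by rewrite [map_poly f (_ *: _ J n)]map_polyZ IH // offE.
Qed.

(** Cancelling the coefficient of degree [d] is the step by which a polynomial is expanded along a
    family with one member in each degree. *)
Lemma size_sub_lead_coef (F : fieldType) (d : nat) (p q : {poly F}) :
  size p = d.+1 -> (size q <= d.+1)%N ->
  (size (q - (q`_d / lead_coef p) *: p)%R <= d)%N.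
Proof.
move=> szp szq.
have p_neq0 : lead_coef p != 0 by rewrite lead_coef_eq0 -size_poly_eq0 szp.
apply/leq_sizeP => j; rewrite leq_eqVlt coefB coefZ => /predU1P[<-|dj].
  by rewrite [p`_d](_ : _ = lead_coef p) ?divfK ?subrr // lead_coefE szp.
rewrite (nth_default _ (leq_trans szq dj)) [p`_j]nth_default ?szp //.
by rewrite mulr0 subrr.
Qed.

(** * The discrete functional and its matrix identities *)

Section Quadrature.
Variables (F : fieldType) (N : nat) (l b : 'I_N -> F).

Definition quadrature (p : {poly F}) : F := \sum_k b k * p.[l k].

Lemma quadrature_is_linear : linear_for *%R quadrature.
Proof.
move=> c p q; rewrite /quadrature mulr_sumr -big_split; apply: eq_bigr => k _.
by rewrite hornerD hornerZ mulrDr mulrCA.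
Qed.

HB.instance Definition _ :=
  GRing.isLinear.Build F {poly F} F *%R quadrature quadrature_is_linear.

Variable p : nat -> {poly F}.
Hypothesis p_orthonormal : forall i j, (i < N)%N -> (j < N)%N ->
  quadrature (p i * p j) = (i == j)%:R.

Definition value_matrix : 'M[F]_N := \matrix_(i, k) (p i).[l k].

(** With A the value matrix and W the diagonal of weights, orthonormality reads A W A^T = 1; a
    one-sided inverse of a square matrix is two-sided, so A^T may be moved to the front. *)
Lemma value_matrix_orthogonal :
  value_matrix^T *m value_matrix *m diag_mx (\row_k b k) = 1%:M.
Proof.
rewrite -mulmxA; apply: mulmx1C; rewrite mul_mx_diag; apply/matrixP => i j.
rewrite !mxE -[in RHS]val_eqE /= -p_orthonormal //; apply: eq_bigr => k _.
by rewrite !mxE hornerM mulrCA mulrA.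
Qed.

Lemma value_matrix_unit : value_matrix \in unitmx.
Proof.
by have := value_matrix_orthogonal; rewrite -mulmxA => /mulmx1C/mulmx1_unit[];
  rewrite unitmx_mul => /andP[].
Qed.

Lemma dual_orthogonality (i j : 'I_N) :
  (\sum_(m < N) (p m).[l i] * (p m).[l j]) * b j = (i == j)%:R.
Proof.
have /matrixP/(_ i j) := value_matrix_orthogonal.
rewrite mul_mx_diag !mxE => <-; congr (_ * _).
by apply: eq_bigr => m _; rewrite !mxE.
Qed.

(** If nodes [i] and [j] coincide, the dual sums for (i, j) and (j, j) are equal, which forces i =
    j. *)
Lemma orthonormal_nodes_inj : injective l.
Proof.
move=> i j lij; apply/eqP; have := dual_orthogonality i j.
rewrite lij dual_orthogonality eqxx.
by case: (i == j) => // /eqP; rewrite oner_eq0.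
Qed.

(** Multiplication by X has matrix A D W A^T, with D the diagonal of nodes; since W A^T A = 1, its
    product with A is A D. *)
Lemma quadrature_mulX_rows (i k : 'I_N) :
  \sum_(j < N) quadrature ('X * p i * p j) * (p j).[l k]
    = l k * (p i).[l k].
Proof.
pose W : 'M[F]_N := diag_mx (\row_k b k).
pose D : 'M[F]_N := diag_mx (\row_k l k).
pose A := value_matrix.
have JE : \matrix_(i, j) quadrature ('X * p i * p j) = A *m D *m W *m A^T.
  apply/matrixP => {}i j; rewrite !mul_mx_diag !mxE; apply: eq_bigr => m _.
  by rewrite !mxE !hornerM hornerX mulrC [l m * _]mulrC mulrAC.
have JA : (A *m D *m W *m A^T) *m A = A *m D.
  rewrite -mulmxA -mulmxA (_ : W *m _ = 1%:M) ?mulmx1 //.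
  exact/mulmx1C/value_matrix_orthogonal.
move: JA; rewrite -JE mul_mx_diag => /matrixP/(_ i k); rewrite !mxE mulrC => <-.
by apply: eq_bigr => j _; rewrite !mxE.
Qed.

End Quadrature.

Lemma quadrature_map (F K : fieldType) (f : {rmorphism F -> K}) (N : nat)
    (l b : 'I_N -> F) (p : {poly F}) :
  quadrature (f \o l) (f \o b) (map_poly f p) = f (quadrature l b p).
Proof.
by rewrite rmorph_sum; apply: eq_bigr => k _; rewrite rmorphM /= horner_map.
Qed.

(** * Gram-Schmidt and construction of the Jacobi matrix *)

Section OrthonormalPolynomials.
Variables (R : rcfType) (N : nat) (l b : 'I_N -> R).
Hypotheses (l_inj : injective l) (b_gt0 : forall k, 0 < b k).
Hypothesis b_sum1 : \sum_k b k = 1.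
Local Notation L := (quadrature l b).

(** A nonzero polynomial of degree below N cannot vanish at all N distinct nodes, and every weight
    is positive. *)
Lemma quadrature_sqr_gt0 (q : {poly R}) : q != 0 -> (size q <= N)%N ->
  0 < L (q * q).
Proof.
move=> q_neq0 szq.
have term_ge0 k : 0 <= b k * (q * q).[l k].
  by rewrite hornerM -expr2 mulr_ge0 ?sqr_ge0 ?ltW.
rewrite lt_neqAle sumr_ge0 // andbT eq_sym; apply: contra_neq q_neq0 => Lq0.
apply: (@roots_geq_poly_eq0 _ _ [seq l k | k <- enum 'I_N]).
- apply/allP => _ /mapP[k _ ->]; apply/rootP/eqP; rewrite -sqrf_eq0 expr2.
  have /eqP := @psumr_eq0P _ _ predT _ (fun i _ => term_ge0 i) Lq0 k isT.
  by rewrite -hornerM mulf_eq0 gt_eqF.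
- by rewrite map_inj_uniq ?enum_uniq.
- by rewrite size_map size_enum_ord.
Qed.

Lemma exists_orthonormal_poly n : (n < N)%N -> exists p : nat -> {poly R},
  [/\ p 0%N = 1, forall i, (i <= n)%N -> size (p i) = i.+1
    & forall i j, (i <= n)%N -> (j <= n)%N -> L (p i * p j) = (i == j)%:R].
Proof.
elim: n => [|n IH] nN.
  exists (fun=> 1); split=> // [[]//|[]//[]//]; first by rewrite size_poly1.
  (* The weights sum to 1, so the constant 1 is already normalized. *)
  move=> _ _; rewrite /quadrature mulr1 -b_sum1.
  by apply: eq_bigr => k _; rewrite hornerC mulr1.
have [p [p0 szp Lp]] := IH (ltnW nN).
(* The orthogonal projection of X^(n+1) onto the span of p_0, ..., p_n. *)
pose r := \sum_(i < n.+1) L ('X^(n.+1) * p i) *: p i.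
pose q := 'X^(n.+1) - r.
have szr : (size r < n.+2)%N.
  rewrite ltnS; apply: (leq_trans (size_sum _ _ _)); apply/bigmax_leqP => i _.
  by rewrite (leq_trans (size_scale_leq _ _)) // szp ?ltn_ord // -ltnS ltn_ord.
have szq : size q = n.+2 by rewrite size_polyDl size_polyXn ?size_polyN.
have Lqp j : (j <= n)%N -> L (q * p j) = 0.
  move=> jn; rewrite mulrBl linearB mulr_suml linear_sum /=.
  rewrite (bigD1 (Ordinal (jn : (j < n.+1)%N))) //= big1 => [|i ij].
    by rewrite -scalerAl linearZ /= Lp // eqxx mulr1 addr0 subrr.
  rewrite -scalerAl linearZ /= Lp -1?ltnS // (_ : _ == _ = false) ?mulr0 //.
  by apply/eqP => ij'; case/eqP: ij; apply/val_inj.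
have Lqq : 0 < L (q * q) by apply: quadrature_sqr_gt0; rewrite -?size_poly_eq0 szq.
pose s := Num.sqrt (L (q * q)).
have s_neq0 : s != 0 by rewrite gt_eqF // sqrtr_gt0.
exists (fun i => if i == n.+1 then s^-1 *: q else p i); split=> // [i|i j].
  by case: eqP => [-> _|/eqP i_n]; rewrite ?size_scale ?invr_eq0 // leq_eqVlt
    (negPf i_n) ltnS; apply: szp.
have Lqsp k : (k <= n)%N -> L (s^-1 *: q * p k) = 0.
  by move=> kn; rewrite -scalerAl linearZ /= Lqp ?mulr0.
rewrite leq_eqVlt (leq_eqVlt j) !ltnS; case: (eqVneq i n.+1) => [->|i_n] /=.
  case: (eqVneq j n.+1) => [->|j_n] /= _ => [_|jn].
    rewrite -scalerAl -scalerAr !linearZ /= -(sqr_sqrtr (ltW Lqq)) -/s.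
    by rewrite expr2 !mulKf ?mulVf.
  by rewrite Lqsp.
case: (eqVneq j n.+1) => [->|j_n] /= => [in' _|]; last exact: Lp.
by rewrite mulrC Lqsp // (negPf i_n).
Qed.

Lemma exists_jacobi_matrix : (0 < N)%N -> exists J : 'M[R]_N,
  [/\ jacobi_matrix J,
      forall m n, (m < N)%N -> (n < N)%N ->
        L (jacobi_poly J m * jacobi_poly J n) = (m == n)%:R
    & forall k, (jacobi_poly J N).[l k] = 0].
Proof.
move=> N_gt0; have predN : (N.-1 < N)%N by rewrite prednK.
have [p [p0 szp0 Lp0]] := exists_orthonormal_poly predN.
have ltN i : (i < N)%N -> (i <= N.-1)%N by move=> iN; rewrite -ltnS prednK.
have szp i : (i < N)%N -> size (p i) = i.+1 by move/ltN/szp0.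
have Lp i j : (i < N)%N -> (j < N)%N -> L (p i * p j) = (i == j)%:R.
  by move=> /ltN iN /ltN jN; apply: Lp0.
(* p_n is orthogonal to every polynomial of lower degree; this will make [J] tridiagonal. *)
have Llow n d (q : {poly R}) : (n < N)%N -> (d <= n)%N -> (size q <= d)%N ->
    L (q * p n) = 0.
  move=> nN; elim: d q => [|d IH] q dn szq.
    by move: szq; rewrite size_poly_leq0 => /eqP ->; rewrite mul0r linear0.
  have dN : (d < N)%N := ltn_trans dn nN.
  rewrite -[q](subrK (q`_d / lead_coef (p d) *: p d)) mulrDl linearD /=.
  rewrite IH ?(ltnW dn) ?size_sub_lead_coef ?szp // add0r -scalerAl linearZ /= Lp //.
  by rewrite ltn_eqF ?mulr0.
pose J : 'M[R]_N := \matrix_(i, j) L ('X * p i * p j).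
have szXp i : (i < N)%N -> size ('X * p i) = i.+2.
  by move=> iN; rewrite mulrC size_mulX -?size_poly_eq0 szp.
have Jjac : jacobi_matrix J.
  split=> [|i j ij|i j ij].
  - by apply/matrixP => i j; rewrite !mxE mulrAC.
  - by rewrite mxE (Llow j j) ?szXp.
  - have iN : (i.+1 < N)%N by rewrite -ij.
    rewrite mxE ij; set q := 'X * p i; have szq : size q = i.+2 by apply: szXp.
    (* X p_i is a multiple of p_(i+1) plus terms of lower degree, so the entry is a ratio of nonzero
       leading coefficients. *)
    rewrite -[q](subrK (q`_i.+1 / lead_coef (p i.+1) *: p i.+1)) mulrDl linearD /=.
    rewrite (Llow _ i.+1) ?size_sub_lead_coef ?szp ?szq // add0r -scalerAl.
    rewrite linearZ /= Lp //.
    rewrite eqxx mulr1 mulf_neq0 ?invr_eq0 //.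
      by rewrite -[i.+1]/(i.+2.-1) -szq -lead_coefE lead_coef_eq0
        -size_poly_eq0 szq.
    by rewrite lead_coef_eq0 -size_poly_eq0 szp.
(* Only p_0, ..., p_(N-1) are controlled; the value 0 at N closes the recurrence and becomes
   P_N(l_k) = 0. *)
pose u k n := if (n < N)%N then (p n).[l k] else 0.
have JP k n : (n <= N)%N -> (jacobi_poly J n).[l k] = u k n.
  apply: jacobi_poly_unique => // [||i].
  - by rewrite /u N_gt0 p0 hornerC.
  - by rewrite /u ltnn.
  - rewrite /u ltn_ord -(quadrature_mulX_rows Lp).
    by apply: eq_bigr => j _; rewrite mxE ltn_ord.
exists J; split=> // [m n mN nN|k]; last by rewrite JP // /u ltnn.
rewrite -Lp //; apply: eq_bigr => k _.
by rewrite !hornerM !JP /u ?mN ?nN // ltnW.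
Qed.

End OrthonormalPolynomials.

(** * Both directions of the characterization of spectral data *)

Section SpectralDataCharacterization.
Variables (R : realType) (N : nat).
Local Notation toC := (real_complex R).
Implicit Types (J : 'M[R]_N) (lambda beta : 'I_N -> R[i]).

(** This bound ensures that [npolyp] leaves the products unchanged, even for m = n = N. *)
Lemma size_jacobi_polyM J m n : jacobi_matrix J -> (m <= N)%N -> (n <= N)%N ->
  (size (jacobi_poly (complexify J) m * jacobi_poly (complexify J) n)%R
     <= (2 * N).+1)%N.
Proof.
move=> /jacobi_complexify Jjac mN nN; apply: (leq_trans (size_polyMleq _ _)).
by rewrite !size_jacobi_poly // addnS /= addSn ltnS mul2n -addnn leq_add.
Qed.

Lemma spectral_data_orthonormal J lambda beta :
  jacobi_matrix J -> spectral_data J lambda beta ->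
  forall m n, (m < N)%N -> (n < N)%N ->
    quadrature lambda beta
      (jacobi_poly (complexify J) m * jacobi_poly (complexify J) n)
    = (m == n)%:R.
Proof.
move=> Jjac [_ [Omega [Omega_orth _] OmegaE]] m n mN nN.
by rewrite -Omega_orth // OmegaE npolypK // size_jacobi_polyM // ltnW.
Qed.

Lemma spectral_data_necessary J lambda beta : (0 < N)%N ->
  jacobi_matrix J -> spectral_data J lambda beta ->
  ((forall k, lambda k \is Num.real) /\ injective lambda) /\
  ((forall k, 0 < beta k) /\ \sum_k beta k = 1).
Proof.
move=> N_gt0 Jjac Jdata; have Porth := spectral_data_orthonormal Jjac Jdata.
have [lambda_eigen _] := Jdata; have [Jsym _ _] := Jjac.
have lambda_real k : lambda k \is Num.real.
  apply: (@eigenvalue_hermitian_real _ _ (complexify J)).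
    move=> i j; rewrite -[in RHS]Jsym !mxE; apply/CrealP.
    by apply/complex_realP; exists (J i j).
  by apply/lambda_eigen; exists k.
split; [split=> //|split=> [k|]].
- exact: orthonormal_nodes_inj Porth.
(* The values P_m(lambda_k) are real, so the sum [s] of their squares is nonnegative, and dual
   orthogonality makes [beta k] its inverse. *)
- pose x m := (jacobi_poly (complexify J) m).[lambda k].
  have x_real m : x m \is Num.real.
    have /complex_realP[t tE] := lambda_real k.
    apply/complex_realP; exists (jacobi_poly J m).[t].
    by rewrite /x tE map_jacobi_poly horner_map.
  have := dual_orthogonality Porth k k; rewrite eqxx.
  set s := \sum_(m < N) _ => sb1.
  have s_ge0 : 0 <= s.
    by apply: sumr_ge0 => m _; rewrite -expr2 real_exprn_even_ge0 ?x_real.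
  have s_neq0 : s != 0.
    by apply: contra_eq_neq sb1 => ->; rewrite mul0r eq_sym oner_eq0.
  have -> : beta k = s^-1 by rewrite -[LHS](mulKf s_neq0) sb1 mulr1.
  by rewrite invr_gt0 lt0r s_neq0.
(* The sum of the weights is the functional at P_0 P_0 = 1. *)
- apply: etrans (Porth 0%N 0%N N_gt0 N_gt0).
  by apply: eq_bigr => k _; rewrite /= mulr1 hornerC mulr1.
Qed.

Lemma spectral_data_sufficient lambda beta : (0 < N)%N ->
  (forall k, lambda k \is Num.real) -> injective lambda ->
  (forall k, 0 < beta k) -> \sum_k beta k = 1 ->
  exists2 J : 'M[R]_N, jacobi_matrix J & spectral_data J lambda beta.
Proof.
move=> N_gt0 lambda_real lambda_inj beta_gt0 beta_sum.
(* The construction runs over the reals, so that [J] is real; [quadE] carries its identities back to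
   the complex data. *)
pose l k := complex.Re (lambda k); pose b k := complex.Re (beta k).
have lE k : toC (l k) = lambda k by apply: RRe_real.
have bE k : toC (b k) = beta k by apply/RRe_real/gtr0_real.
have l_inj : injective l.
  by move=> i j lij; apply: lambda_inj; rewrite -!lE lij.
have b_gt0 k : 0 < b k by rewrite -ltcR bE.
have b_sum : \sum_k b k = 1.
  by apply: (fmorph_inj toC); rewrite rmorph_sum rmorph1 -beta_sum;
    apply: eq_bigr => k _; apply: bE.
have [J [Jjac Porth PN]] := exists_jacobi_matrix l_inj b_gt0 b_sum N_gt0.
have quadE q : quadrature lambda beta (map_poly toC q) = toC (quadrature l b q).
  rewrite -quadrature_map; apply: eq_bigr => k _ /=.
  by rewrite lE bE.
have Cjac := jacobi_complexify Jjac.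
pose P := jacobi_poly (complexify J).
have PE n : P n = map_poly toC (jacobi_poly J n) by apply: map_jacobi_poly.
have CPorth m n : (m < N)%N -> (n < N)%N ->
    quadrature lambda beta (P m * P n) = (m == n)%:R.
  by move=> mN nN; rewrite !PE -rmorphM quadE Porth // rmorph_nat.
have CPN k : (P N).[lambda k] = 0.
  by rewrite PE -lE horner_map PN rmorph0.
exists J => //; split.
  move=> x; rewrite (eigenvalue_similar_diag (A := value_matrix lambda P)
    (d := \row_k lambda k)); first 1 last.
  - exact: value_matrix_unit CPorth.
  - apply/matrixP => i k; rewrite mul_mx_diag !mxE mulrC.
    rewrite -(jacobi_poly_eigen Cjac) //.
    by apply: eq_bigr => j _; rewrite !mxE.
  by split=> -[k ->]; exists k; rewrite mxE.
have OmegaE m n : (m <= N)%N -> (n <= N)%N ->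
    quadrature lambda beta (npolyp (2 * N).+1 (P m * P n))
    = quadrature lambda beta (P m * P n).
  by move=> mN nN; rewrite npolypK // size_jacobi_polyM.
exists (quadrature lambda beta \o val : {scalar {poly_(2 * N).+1 R[i]}}) => //.
split=> [m n mN nN|m mN].
  by apply: etrans (OmegaE m n (ltnW mN) (ltnW nN)) _; apply: CPorth.
apply: etrans (OmegaE m N mN (leqnn N)) _.
(* P_N vanishes at every node, so every term of the sum is zero. *)
by apply: big1 => k _; rewrite hornerM CPN !mulr0.
Qed.

End SpectralDataCharacterization.

Theorem theorem10 (R : realType) (N : nat) (N_gt0 : (0 < N)%N)
    (lambda beta : 'I_N -> R[i]) :
  (exists2 J : 'M[R]_N, jacobi_matrix J & spectral_data J lambda beta) <->
  ((forall k, lambda k \is Num.real) /\ injective lambda) /\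
  ((forall k, 0 < beta k) /\ \sum_k beta k = 1).
Proof.
split=> [[J Jjac Jdata]|[[? ?] [? ?]]].
  exact: spectral_data_necessary Jdata.
exact: spectral_data_sufficient.
Qed.
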